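(* Consider $(\gamma,u,\lambda)\in\mathbb{R}^n\times\mathbb{R}^n\times\mathbb{R}^m$ with $\lambda>0$. Let $v\in\mathbb{R}^m$ and $\mu>0$ satisfy $\lambda=\sqrt\mu e^{v}$. Let $(\Delta\gamma,\Delta u,\Delta\lambda)\in\mathbb{R}^n\times\mathbb{R}^n\times\mathbb{R}^m$ solve the dual barrier Newton system (with this $\mu$) $$W(u+\Delta u) = W(\gamma+\Delta\gamma),\qquad A^T(\lambda+\Delta\lambda) = W(u+\Delta u)+c,\qquad A(\gamma+\Delta\gamma)+b = \mu(\lambda^{-1}-\lambda^{-2}\circ\Delta\lambda).$$ Then $\lambda+\Delta\lambda = \lambda\circ(\mathbf{1}+d(v,\mu))$, where $d(v,\mu)$ is the log-domain Newton direction.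
   Context: Data and standing assumptions: $A\in\mathbb{R}^{m\times n}$, $b\in\mathbb{R}^m$, $c\in\mathbb{R}^n$, and $W\in\mathbb{R}^{n\times n}$ is symmetric positive semidefinite. It is assumed that (i) there exists $x\in\mathbb{R}^n$ with $Ax+b>0$ (componentwise); (ii) for every $\beta\in\mathbb{R}$ the set $\{x\in\mathbb{R}^n: \frac12 x^TWx + c^Tx\le\beta,\ Ax+b\ge0\}$ is bounded; (iii) $A^TA+W$ is positive definite. Notation: $\circ$ is the elementwise product; $e^v$, $\lambda^{-1}$, $\lambda^{-2}$ are taken elementwise; $\mathbf{1}\in\mathbb{R}^m$ is the all-ones vector. Log-domain Newton direction: for $v\in\mathbb{R}^m$ and $\mu>0$, $d(v,\mu)\in\mathbb{R}^m$ is the (unique) $d$ that, together with a (unique) $x\in\mathbb{R}^n$, satisfies $\sqrt\mu A^T(e^v+e^v\circ d) = Wx+c$ and $\sqrt\mu(e^{-v}-e^{-v}\circ d) = Ax+b$. The dual barrier Newton system is the linearization at $(\gamma,u,\lambda)$ of the optimality conditions $Wu=W\gamma$, $A^T\lambda = Wu+c$, $A\gamma+b=\mu\lambda^{-1}$ of the problem: minimize $\frac12u^TWu+b^T\lambda-\mu\sum_{i=1}^m\log\lambda_i$ over $(u,\lambda)$ subject to $A^T\lambda=Wu+c$, where $\gamma$ is a Lagrange multiplier for the equality constraints. *)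

(* Defs.v *)
From mathcomp Require Import all_boot all_order all_algebra.
From mathcomp Require Import all_classical all_reals all_analysis.

Set Implicit Arguments.
Unset Strict Implicit.
Unset Printing Implicit Defensive.

Import Order.TTheory GRing.Theory Num.Theory.
Import numFieldNormedType.Exports.

Local Open Scope classical_set_scope.
Local Open Scope ring_scope.

Reserved Notation "x \odot y" (at level 40, left associativity).
Notation "x \odot y" := (map2_mx *%R x y) : ring_scope.

Section Definitions.
Context {R : realType}.

Definition expv m (v : 'cV[R]_m) : 'cV[R]_m := map_mx expR v.
Definition dotv n (x y : 'cV[R]_n) : R := (x^T *m y) 0 0.
Definition quadform n (M : 'M[R]_n) (x : 'cV[R]_n) : R := dotv x (M *m x).

Definition psdmx n (M : 'M[R]_n) : Prop :=
  M \is symmetricmx /\ forall x : 'cV[R]_n, 0 <= quadform M x.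

Definition posdefmx n (M : 'M[R]_n) : Prop :=
  M \is symmetricmx /\ forall x : 'cV[R]_n, x != 0 -> 0 < quadform M x.

Definition posv m (y : 'cV[R]_m) : Prop := forall i, 0 < y i 0.
Definition nnegv m (y : 'cV[R]_m) : Prop := forall i, 0 <= y i 0.

Section QP.
Context {m n : nat}.
Variables (A : 'M[R]_(m, n)) (b : 'cV[R]_m) (c : 'cV[R]_n) (W : 'M[R]_n).

Definition sublevel_set (beta : R) : set 'cV[R]_n :=
  [set x | 2^-1 * quadform W x + dotv c x <= beta /\ nnegv (A *m x + b)].

Definition log_newton_system (v : 'cV[R]_m) (mu : R)
    (x : 'cV[R]_n) (d : 'cV[R]_m) : Prop :=
  Num.sqrt mu *: (A^T *m (expv v + expv v \odot d)) = W *m x + c /\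
  Num.sqrt mu *: (expv (- v) - expv (- v) \odot d) = A *m x + b.

(* A definite description: [get] selects an element of the set when it is
   nonempty.  The set is a singleton as soon as 0 < mu, W is positive
   semidefinite and A^T *m A + W is positive definite. *)
Definition log_newton_dir (v : 'cV[R]_m) (mu : R) : 'cV[R]_m :=
  get [set d | exists x, log_newton_system v mu x d].

Definition dual_barrier_newton_system (mu : R)
    (gamma u : 'cV[R]_n) (lambda : 'cV[R]_m)
    (dgamma du : 'cV[R]_n) (dlambda : 'cV[R]_m) : Prop :=
  [/\ W *m (u + du) = W *m (gamma + dgamma),
      A^T *m (lambda + dlambda) = W *m (u + du) + c &
      A *m (gamma + dgamma) + b =
        mu *: (map_mx (fun t => t^-1) lambda
               - map_mx (fun t => t ^- 2) lambda \odot dlambda)].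

End QP.
End Definitions.

(* Main.v *)
Require Import Defs.
From mathcomp Require Import all_boot all_order all_algebra.
From mathcomp Require Import all_classical all_reals all_analysis.
From mathcomp Require Import ring.
Import Order.TTheory GRing.Theory Num.Theory.
Import numFieldNormedType.Exports.
Local Open Scope classical_set_scope.
Local Open Scope ring_scope.

(** With the relative step [d] = lambda^-1 \odot dlambda, the new iterate is lambda \odot (1 + d).
    Substituting lambda = sqrt mu e^v into the dual barrier system, and using its first equation to
    trade u + du for gamma + dgamma, gives exactly the log-domain system with x = gamma + dgamma. So
    [d] solves that system, and [log_newton_system_inj] (uniqueness in d) identifies it with
    [log_newton_dir]. *)

(* The difference (x, d) of two solutions satisfies x^T W x = - mu |d|^2. *)
Lemma log_newton_system_inj {R : realType} {m n : nat}
    {A : 'M[R]_(m, n)} {b : 'cV[R]_m} {c : 'cV[R]_n} {W : 'M[R]_n}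
    {v : 'cV[R]_m} {mu : R} {x1 x2 : 'cV[R]_n} {d1 d2 : 'cV[R]_m} :
  psdmx W -> 0 < mu ->
  log_newton_system A b c W v mu x1 d1 ->
  log_newton_system A b c W v mu x2 d2 -> d1 = d2.
Proof.
move=> [_ W_ge0] mu_gt0 [W1 A1] [W2 A2].
have We : W *m (x1 - x2) =
    Num.sqrt mu *: (A^T *m (expv v \odot (d1 - d2))).
  have -> : W *m (x1 - x2) = (W *m x1 + c) - (W *m x2 + c).
    by rewrite mulmxBr opprD addrACA subrr addr0.
  rewrite -W1 -W2 -scalerBr -mulmxBr.
  by congr (_ *: (_ *m _)); apply/matrixP => i j; rewrite !mxE; ring.
have Ae i : (A *m (x1 - x2)) i 0 =
    - (Num.sqrt mu * expR (- v i 0) * (d1 i 0 - d2 i 0)).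
  have -> : A *m (x1 - x2) = (A *m x1 + b) - (A *m x2 + b).
    by rewrite mulmxBr opprD addrACA subrr addr0.
  by rewrite -A1 -A2 !mxE; ring.
(* The factors e^v and e^-v, one from each equation, cancel entrywise; the two factors sqrt mu
   combine into mu. *)
have quadE : quadform W (x1 - x2) = - (mu * \sum_i (d1 i 0 - d2 i 0) ^+ 2).
  rewrite /quadform /dotv We -scalemxAr mulmxA -trmx_mul !mxE.
  rewrite !mulr_sumr -sumrN; apply: eq_bigr => i _.
  rewrite mxE Ae !mxE -{3}(sqr_sqrtr (ltW mu_gt0)).
  have := expRxMexpNx_1 (v i 0).
  set E := expR _; set F := expR _ => EF.
  by rewrite -[RHS]mulr1 -EF; ring.
have sum_ge0 : 0 <= \sum_i (d1 i 0 - d2 i 0) ^+ 2.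
  by apply: sumr_ge0 => i _; exact: sqr_ge0.
(* Semidefiniteness of [W] makes the left side of [quadE] nonnegative, whereas its right side is
   nonpositive since mu > 0. *)
have /eqP : \sum_i (d1 i 0 - d2 i 0) ^+ 2 = 0.
  apply/le_anti; rewrite sum_ge0 andbT -(pmulr_rle0 _ mu_gt0) -oppr_ge0 -quadE.
  exact: W_ge0.
rewrite psumr_eq0 => [/allP d12|i _]; last exact: sqr_ge0.
apply/colP => i; apply/eqP; rewrite -subr_eq0 -sqrf_eq0.
exact: (d12 i (mem_index_enum i)).
Qed.

Theorem proposition4p2 (R : realType) (m n : nat)
    (A : 'M[R]_(m, n)) (b : 'cV[R]_m) (c : 'cV[R]_n) (W : 'M[R]_n)
    (W_psd : psdmx W)
    (strictly_feasible : exists x : 'cV[R]_n, posv (A *m x + b))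
    (bounded_sublevels : forall beta : R, bounded_set (sublevel_set A b c W beta))
    (AW_posdef : posdefmx (A^T *m A + W))
    (gamma u : 'cV[R]_n) (lambda : 'cV[R]_m) (lambda_gt0 : posv lambda)
    (v : 'cV[R]_m) (mu : R) (mu_gt0 : 0 < mu)
    (lambdaE : lambda = Num.sqrt mu *: expv v)
    (dgamma du : 'cV[R]_n) (dlambda : 'cV[R]_m)
    (newton : dual_barrier_newton_system A b c W mu gamma u lambda
                dgamma du dlambda) :
  lambda + dlambda = lambda \odot (const_mx 1 + log_newton_dir A b c W v mu).
Proof.
case: newton => Wu Au Ag.
set s := Num.sqrt mu in lambdaE *.
have s_gt0 : 0 < s by rewrite sqrtr_gt0.
have s_neq0 : s != 0 by rewrite gt_eqF.
have muE : mu = s ^+ 2 by rewrite sqr_sqrtr // ltW.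
pose d := map_mx (fun t => t^-1) lambda \odot dlambda.
have lambdaD : lambda + dlambda = lambda \odot (const_mx 1 + d).
  apply/colP => i; rewrite !mxE; field.
  by rewrite gt_eqF // lambda_gt0.
(* In the second equation, mu lambda^-1 = sqrt mu e^-v, and mu lambda^-2 \odot dlambda = mu
   lambda^-1 \odot d = sqrt mu e^-v \odot d. *)
have d_newton : log_newton_system A b c W v mu (gamma + dgamma) d.
  split.
    rewrite -Wu -Au scalemxAr lambdaD; congr (_ *m _).
    by apply/colP => i; rewrite /d lambdaE !mxE -/s; ring.
  rewrite Ag; apply/colP => i; rewrite /d lambdaE !mxE -/s muE expRN; field.
  by rewrite s_neq0 gt_eqF // expR_gt0.
rewrite lambdaD; congr (_ \odot (_ + _)).
(* [get] is only known to return a member once the set is inhabited; [d] itself is the witness, so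
   existence comes from the given Newton step. *)
have dir_ex : [set d' | exists x, log_newton_system A b c W v mu x d'] d.
  by exists (gamma + dgamma).
have [x dir_newton] := getPex (ex_intro _ d dir_ex).
exact: (log_newton_system_inj W_psd mu_gt0 d_newton dir_newton).
Qed.
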